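(* Let $C$ be a non-empty compact convex set in $\mathbb{R}^N$, and let $\zeta$ be a non-empty, convex and compact valued correspondence from $C$ to $\mathbb{R}^N$ (that is, $\zeta(x)\subset\mathbb{R}^N$ is non-empty, convex and compact for every $x\in C$). If $\zeta$ is upper semi-continuous on $C$, then there exist some $x \in C$ and $z \in \zeta(x)$ such that $$\langle p,z \rangle \le \langle x,z \rangle \quad \text{for all } p \in C.$$
   Context: $\langle\cdot,\cdot\rangle$ is the standard inner product on $\mathbb{R}^N$. A correspondence $\Gamma: X \rightrightarrows Y$ between non-empty topological spaces assigns to each $x\in X$ a subset $\Gamma(x)\subset Y$; for $U\subset X$, $\Gamma(U)=\bigcup_{x\in U}\Gamma(x)$. $\Gamma$ is upper semi-continuous at $x \in X$ if, for every open set $V \subset Y$ with $\Gamma(x)\subset V$, there exists a neighborhood $U \subset X$ of $x$ such that $\Gamma(U)\subset V$; it is upper semi-continuous on $X$ if it is so at every point of $X$. *)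

(* Defs.v *)
From HB Require Import structures.
From mathcomp Require Import all_boot all_order all_algebra.
From mathcomp Require Import all_classical all_reals all_analysis.

Set Implicit Arguments.
Unset Strict Implicit.
Unset Printing Implicit Defensive.

Import Order.TTheory GRing.Theory Num.Theory.
Import numFieldNormedType.Exports.

Local Open Scope classical_set_scope.
Local Open Scope ring_scope.

Definition correspondence (X Y : Type) : Type := X -> set Y.

Definition corr_image (X Y : Type) (Gamma : correspondence X Y) (U : set X) :
  set Y := \bigcup_(x in U) Gamma x.

Definition upper_semicontinuous_at (X Y : topologicalType)
    (Gamma : correspondence X Y) (x : X) : Prop :=
  forall V : set Y, open V -> Gamma x `<=` V ->
    exists2 U : set X, nbhs x U & corr_image Gamma U `<=` V.

Definition upper_semicontinuous (X Y : topologicalType)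
    (Gamma : correspondence X Y) : Prop :=
  forall x : X, upper_semicontinuous_at Gamma x.

(* [dotmx] of spectral.v is the Hermitian product over a numClosedFieldType
   and does not apply to a realType. *)
Definition inner (R : realType) (N : nat) (u v : 'rV[R]_N) : R :=
  \sum_(i < N) u ord0 i * v ord0 i.

(* Main.v *)
Require Import Defs.
From HB Require Import structures.
From mathcomp Require Import all_boot all_order all_algebra.
From mathcomp Require Import all_classical all_reals all_analysis.
From mathcomp Require Import ring lra.

(** Suppose that there is no solution: at every [x] in [C], each [z] in [zeta x]
    is improved upon by some [p] in [C], that is [<p, z> > <x, z>].  A minimax
    argument makes [p] depend on [x] only, and upper semi-continuity makes it
    work on a closed ball around [x] ([improving_direction_near]).  By
    compactness finitely many such balls cover [C], with centres [s i] and
    points [p i].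

    Send a point [l] of the simplex to [y l = \sum_i l_i p_i], a point of [C].
    The sets of those [l] for which [y l] is in the ball of index [i] are closed
    and cover the simplex, so that some [l] belongs to the [i]-th set for every
    [i] with [l_i > 0] ([simplex_closed_cover]).  For [z] in [zeta (y l)] each
    such [p_i] satisfies [<p_i - y l, z> > 0], although the mean of the [p_i]
    with weights [l_i] is [y l] itself: a contradiction.

    The covering lemma is where the strength of Brouwer's theorem enters.  It is
    the limit of a statement on colourings of the grid points of the simplex
    ([grid_colorful]), itself deduced from Scarf's lemma
    ([scarf_colorful_room]).  That lemma is a parity argument like Sperner's, in
    which the cells are defined by linear orders on a finite set instead of a
    triangulation. *)

Set Implicit Arguments.
Unset Strict Implicit.
Unset Printing Implicit Defensive.

(** * Scarf's parity lemma for several linear orders *)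

Section Scarf.
Import mathcomp.boot.fintype mathcomp.boot.finset.

(** The counting step of Sperner's lemma.  If some [S :\ x] misses only the
    colour [i0] but [S] misses [i0] too, then the colour of [x] occurs exactly
    once more in [S], at [y] say, and the two deletions that work are those of
    [x] and of [y]. *)
Lemma odd_color_walls (X I : finType) (c : X -> I) (i0 : I)
    (S : {set X}) : #|S| = #|I| ->
  odd #|[set x in S | c @: (S :\ x) == [set~ i0]]| = (c @: S == [set: I]).
Proof.
move=> cS; have cT : #|[set: I]| = #|S| by rewrite cardsT.
have [cST|cSNT] := eqVneq (c @: S) [set: I].
  have c_inj : {in S &, injective c} by apply/imset_injP; rewrite cST cT.
  have wallE x : x \in S -> c @: (S :\ x) = [set~ c x].
    move=> xS; apply/setP => i; rewrite !inE.
    apply/imsetP/idP => [[y /[!inE] /andP[yx yS] ->]|ix].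
      by apply: contra_neq yx; apply: c_inj.
    have /imsetP[y yS iy] : i \in c @: S by rewrite cST inE.
    by exists y => //; rewrite !inE yS andbT; apply: contra_neq ix => <-.
  have /imsetP[x xS i0x] : i0 \in c @: S by rewrite cST inE.
  rewrite (_ : [set _ in _ | _] = [set x]) ?cards1//.
  apply/setP => y; rewrite !inE.
  apply/andP/eqP => [[yS]|->]; last by rewrite xS wallE// i0x.
  by rewrite wallE// i0x => /eqP/setC_inj/set1_inj/c_inj; apply.
have [->|[x]] := set_0Vmem [set x in S | c @: (S :\ x) == [set~ i0]].
  by rewrite cards0.
rewrite inE => /andP[xS /eqP cx].
have cxi0 : c x != i0.
  apply: contra_neq cSNT => cxi0.
  by rewrite -(setD1K xS) imsetU1 cx cxi0 setUCr.
have /imsetP[y] : c x \in c @: (S :\ x) by rewrite cx !inE.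
rewrite !inE => /andP[yx yS] cxy.
have c_inj : {in S :\ x &, injective c}.
  apply/imset_injP; rewrite cx cardsC1 -cS (cardsD1 x S) xS.
  by rewrite add1n.
rewrite (_ : [set _ in _ | _] = [set x; y]) ?cards2 1?eq_sym ?yx//.
apply/setP => w; rewrite !inE; apply/andP/orP; last first.
  case=> /eqP ->; split=> //; rewrite ?cx// -cx eqEsubset.
  apply/andP; split; apply/subsetP => _ /imsetP[u /[!inE] /andP[uy uS] ->].
    have [->|ux] := eqVneq u x; last by rewrite imset_f// !inE ux.
    by rewrite cxy imset_f// !inE yx.
  have [->|uy'] := eqVneq u y; last by rewrite imset_f// !inE uy'.
  by rewrite -cxy imset_f// !inE eq_sym yx.
case=> wS /eqP cw.
have [->|wx] := eqVneq w x; [by left|right].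
have : c w \in c @: (S :\ w).
  by rewrite cw -cx imset_f// !inE wx.
case/imsetP=> u /[!inE] /andP[uw uS] cwu.
have [ux|ux] := eqVneq u x.
  by apply/eqP/c_inj; rewrite ?inE ?wx ?yx// cwu ux.
by case/eqP: uw; apply: c_inj; rewrite ?inE ?ux ?wx.
Qed.

Variables (X I : finType) (k : I -> X -> nat).
Hypothesis k_inj : forall i, injective (k i).

(** [S] is dominant when no point of [X] exceeds the minimum of [S] in every
    order at once; the order of index [i] on [X] is read off from the injection
    [k i] into [nat].  Dominant sets of cardinal [#|I|] play the part of the
    cells of a triangulation, those with one point less that of its walls. *)
Definition dominant (S : {set X}) :=
  [forall y, exists i, forall x in S, k i y <= k i x].

Lemma dominantP (S : {set X}) :
  reflect (forall y, exists i, forall x, x \in S -> k i y <= k i x)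
          (dominant S).
Proof.
apply: (iffP forallP) => H y.
  by have /existsP[i /forall_inP Hi] := H y; exists i.
by have [i Hi] := H y; apply/existsP; exists i; apply/forall_inP.
Qed.

Lemma dominantS (A B : {set X}) : A \subset B -> dominant B -> dominant A.
Proof.
move=> /subsetP sAB /dominantP domB; apply/dominantP => y.
by have [i Hi] := domB y; exists i => x /sAB; apply: Hi.
Qed.

(** Dominance of [D] makes [i |-> m i], the [i]-least point of [D], a
    surjection [I -> D].  When [D] has one point less than [I], exactly one pair
    of indices [a], [b] is identified by it, so that removing an index keeps the
    map onto [D] exactly when that index is [a] or [b]. *)
Lemma dominant_collision (D : {set X}) : #|D|.+1 = #|I| -> D != set0 ->
  dominant D ->
  exists (m : I -> X) (a b : I),
    [/\ a != b,
        forall i, m i \in D /\ forall x, x \in D -> k i (m i) <= k i x,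
        forall j, j \in [set a; b] -> m @: [set~ j] = D,
        forall j, j \in [set a; b] -> {in [set~ j] &, injective m} &
        forall j, m @: [set~ j] = D -> j \in [set a; b]].
Proof.
move=> cD /set0Pn[x0 x0D] domD.
pose m i := [arg min_(x < x0 in D) k i x].
have mP i : m i \in D /\ forall x, x \in D -> k i (m i) <= k i x.
  by rewrite /m; case: arg_minnP.
have m_onto x : x \in D -> exists i, m i = x.
  move=> xD; have /dominantP/(_ x)[i Hi] := domD.
  exists i; apply: (@k_inj i); apply/eqP.
  by rewrite eqn_leq (mP i).2//= Hi// (mP i).1.
have : ~~ [forall a, forall b, (m a == m b) ==> (a == b)].
  apply/negP => /forallP m_inj.
  have : #|m @: [set: I]| = #|I|.
    rewrite card_imset ?cardsT// => a b mab.
    by have /forallP/(_ b)/implyP := m_inj a; rewrite mab eqxx => /(_ isT)/eqP.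
  have /subset_leq_card : m @: [set: I] \subset D.
    by apply/subsetP => _ /imsetP[i _ ->]; apply: (mP i).1.
  by rewrite -cD => /[swap] ->; rewrite ltnn.
rewrite negb_forall => /existsP[a]; rewrite negb_forall => /existsP[b].
rewrite negb_imply => /andP[/eqP mab ab].
have card_inj j : m @: [set~ j] = D -> {in [set~ j] &, injective m}.
  by move=> mj; apply/imset_injP; rewrite mj cardsC1 -cD.
have img j : j \in [set a; b] -> m @: [set~ j] = D.
  move=> jab; apply/setP => x; apply/imsetP/idP => [[i _ ->]|/m_onto[i <-]].
    exact: (mP i).1.
  have [->|ij] := eqVneq i j; last by exists i; rewrite ?inE.
  move: jab; rewrite !inE => /orP[]/eqP->.
    by exists b; rewrite ?inE// eq_sym.
  by exists a; rewrite ?inE.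
exists m, a, b; split=> //; first by move=> j /img/card_inj.
move=> j mj; apply/negPn/negP; rewrite !inE negb_or => /andP[ja jb].
case/eqP: ab; apply: (card_inj _ mj) => //; by rewrite !inE eq_sym.
Qed.

(** The point [e i] is least in the order [i], and in the other orders lies
    above every point outside the range of [e]: it stands for the facet of a
    simplex on which the coordinate [i] vanishes. *)
Variable e : I -> X.
Hypotheses (e_min : forall i y, k i (e i) <= k i y)
  (e_top : forall i j y, i != j -> y \notin codom e -> k i y < k i (e j)).

(** An inner wall bounds zero or two cells.  With [a], [b] as in
    [dominant_collision], a point [y] completes [D] to a dominant set exactly
    when, for [j = a] or [j = b], it is the [j]-greatest of the points that
    exceed the minimum of [D] in all orders but [j].  Such points exist because
    [e j] is one of them, and the two choices of [j] give distinct points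
    because no point exceeds the minimum of [D] in all orders. *)
Lemma even_door_rooms (D : {set X}) : #|D|.+1 = #|I| ->
  ~~ (D \subset codom e) ->
  ~~ odd #|[set y in ~: D | dominant (y |: D)]|.
Proof.
move=> cD /subsetPn[x0 x0D x0e].
have [->|[y0]] := set_0Vmem [set y in ~: D | dominant (y |: D)].
  by rewrite cards0.
rewrite inE => /andP[_ /(dominantS (subsetUr _ _)) domD].
have D0 : D != set0 by apply/set0Pn; exists x0.
have [m [a [b [ab mP m_img m_inj m_ab]]]] := dominant_collision cD D0 domD.
pose M j := [pred y | [forall (i | i != j), k i (m i) < k i y]].
have MP j y : reflect (forall i, i != j -> k i (m i) < k i y) (M j y).
  exact: forall_inP.
have notM x : x \in D -> forall j, j \in [set a; b] -> ~~ M j x.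
  move=> xD j /m_img mj; apply/negP => /MP Mx.
  have /imsetP[i /[!inE] ij xmi] : x \in m @: [set~ j] by rewrite mj.
  by have := Mx i ij; rewrite xmi ltnn.
have eM j : M j (e j).
  apply/MP => i ij; apply: leq_ltn_trans (e_top ij x0e).
  exact: (mP i).2.
pose top j := [arg max_(y > e j | M j y) k j y].
have topP j : M j (top j) /\ forall y, M j y -> k j y <= k j (top j).
  by rewrite /top; case: arg_maxnP (eM j).
have domE y : (y \in ~: D) && dominant (y |: D) = (y \in [set top a; top b]).
  apply/idP/idP.
    rewrite inE => /andP[yD /dominantP domy].
    have [j Hj] := domy y.
    have onto x : x \in D -> exists2 i, i != j & m i = x /\ k i x <= k i y.
      move=> xD; have [i Hi] := domy x; exists i.
        apply/eqP => ij; case/negP: yD; rewrite (_ : y = x)//.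
        apply: (@k_inj j); apply/eqP.
        by rewrite eqn_leq Hj ?inE ?xD ?orbT//= -ij Hi// !inE eqxx.
      split; last by apply: Hi; rewrite !inE eqxx.
      apply: (@k_inj i); apply/eqP; rewrite eqn_leq (mP i).2//=.
      by apply: Hi; rewrite !inE (mP i).1 orbT.
    have mj : m @: [set~ j] = D.
      apply/setP => x; apply/imsetP/idP => [[i _ ->]|/onto[i ij [<- _]]].
        exact: (mP i).1.
      by exists i; rewrite ?inE.
    have jab := m_ab _ mj.
    have yM : M j y.
      apply/MP => i ij.
      have [i' i'j [mi' le_y]] := onto _ (mP i).1.
      have ii' : i' = i by apply: (m_inj _ jab); rewrite ?inE.
      move: le_y; rewrite ii' leq_eqVlt => /predU1P[/k_inj my|//].
      by case/negP: yD; rewrite -my (mP i).1.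
    have ytop : y = top j.
      apply: (@k_inj j); apply/eqP; rewrite eqn_leq (topP j).2//=.
      have [i Hi] := domy (top j).
      have [ij|ij] := eqVneq i j; first by
        move: Hi; rewrite ij; apply; rewrite !inE eqxx.
      have := Hi (m i); rewrite !inE (mP i).1 orbT => /(_ isT).
      by have /MP/(_ i ij) := (topP j).1; rewrite ltnNge => /negP.
    by move: jab; rewrite ytop !inE => /orP[]/eqP ->; rewrite eqxx ?orbT.
  move=> yab.
  have [j jab ->] : exists2 j, j \in [set a; b] & y = top j.
    by move: yab; rewrite !inE => /orP[]/eqP->; [exists a|exists b];
      rewrite ?inE ?eqxx ?orbT.
  have [topM top_max] := topP j.
  apply/andP; split.
    by rewrite inE; apply: contraL topM => tD; apply: notM.
  apply/dominantP => w; case: (boolP (M j w)) => [wM|].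
    exists j => x; rewrite !inE => /predU1P[->|xD]; first exact: top_max.
    have /dominantP/(_ w)[i Hi] := domD.
    have [<-|ij] := eqVneq i j; first exact: Hi.
    by have /MP/(_ i ij) := wM; rewrite ltnNge Hi// (mP i).1.
  rewrite negb_forall_in => /existsP[i /andP[ij]]; rewrite -leqNgt => le_w.
  exists i => x; rewrite !inE => /predU1P[->|xD].
    by apply: leq_trans le_w _; apply/ltnW; move/MP: topM; apply.
  by apply: leq_trans le_w _; apply: (mP i).2.
rewrite (_ : [set _ in _ | _] = [set top a; top b]); last first.
  by apply/setP => y; rewrite -domE inE.
rewrite cards2 (_ : _ != _ = true)//; apply/eqP => tab.
have /dominantP/(_ (top a))[i Hi] := domD.
have /negP[] : ~~ (k i (m i) < k i (top a)) by rewrite -leqNgt Hi// (mP i).1.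
have [ia|ia] := eqVneq i a; last by have /MP := (topP a).1; apply.
by rewrite tab; have /MP := (topP b).1; apply; rewrite ia.
Qed.

(** The boundary wall made of all the [e i] with [i != i0] bounds a single cell,
    completed by the [i0]-greatest point outside the range of [e]. *)
Lemma single_slack_room (i0 : I) (x0 : X) : x0 \notin codom e ->
  injective e ->
  #|[set y in ~: (e @: [set~ i0]) | dominant (y |: (e @: [set~ i0]))]| = 1.
Proof.
move=> x0e e_inj; set D := e @: _.
pose t := [arg max_(y > x0 | y \notin codom e) k i0 y].
have [te t_max] : t \notin codom e /\
    forall y, y \notin codom e -> k i0 y <= k i0 t.
  by rewrite /t; case: arg_maxnP.
rewrite (_ : [set _ in _ | _] = [set t]) ?cards1//.
have not_below i y : i != i0 -> y \notin codom e ->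
    exists2 x, x \in D & k i x < k i y.
  move=> ii0 ye; exists (e i); first by rewrite imset_f// !inE.
  rewrite ltn_neqAle e_min andbT; apply: contraNneq ye => /k_inj <-.
  exact: codom_f.
apply/setP => y; rewrite in_set1 !inE.
apply/andP/eqP => [[yD /dominantP domy]|->].
  have [i Hi] := domy t.
  have [ii0|ii0] := eqVneq i i0; last first.
    have [x xD] := not_below _ _ ii0 te.
    by rewrite ltnNge Hi// !inE xD orbT.
  have ty : k i0 t <= k i0 y by rewrite -ii0 Hi// !inE eqxx.
  have ye : y \notin codom e.
    apply/codomP => -[j yj].
    have ji0 : j = i0.
      by apply: contraNeq yD => ji0; rewrite yj imset_f// !inE.
    have := e_min i0 t; rewrite leq_eqVlt => /predU1P[/k_inj et|].
      by case/negP: te; rewrite -et codom_f.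
    by rewrite ltnNge -ji0 -yj ji0 ty.
  by apply: (@k_inj i0); apply/eqP; rewrite eqn_leq ty t_max.
split; first by apply: contra te => /imsetP[j _ ->]; rewrite codom_f.
apply/dominantP => w.
have [/codomP[j ->]|we] := boolP (w \in codom e); first by exists j.
exists i0 => x; rewrite !inE => /predU1P[->|/imsetP[j]]; first exact: t_max.
by rewrite !inE => ji0 ->; rewrite ltnW// e_top// eq_sym.
Qed.

(** Scarf's lemma.  The pairs of a cell and a wall of it that carries all
    colours but [i0] are counted in two ways.  By walls the count is odd: one
    cell for the boundary wall, an even number for each inner one.  By cells,
    the odd contributions are those of the cells that carry all colours. *)
Lemma scarf_colorful_room (c : X -> I) (x0 : X) : x0 \notin codom e ->
  cancel e c ->
  exists S : {set X}, [/\ #|S| = #|I|, dominant S & c @: S = [set: I]].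
Proof.
move=> x0e ec; pose i0 := c x0.
pose room (S : {set X}) := (#|S| == #|I|) && dominant S.
pose wall (D : {set X}) := c @: D == [set~ i0].
have even_sum (P : pred {set X}) (F : {set X} -> nat) :
    (forall A, P A -> ~~ odd (F A)) -> ~~ odd (\sum_(A | P A) F A).
  move=> FP; apply: (big_ind (fun n => ~~ odd n)) => // n1 n2.
  by rewrite oddD => /negbTE -> /negbTE ->.
(* The incidences (S, x) and (D, y) correspond by D = S :\ x, S = y |: D. *)
have count : \sum_(S | room S) #|[set x in S | wall (S :\ x)]| =
    \sum_(D | wall D) #|[set y in ~: D | room (y |: D)]|.
  under eq_bigr => S _ do rewrite -sum1dep_card.
  under [RHS]eq_bigr => D _ do rewrite -sum1dep_card.
  rewrite !pair_big_dep /=.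
  rewrite (reindex_onto (fun p : {set X} * X => (p.2 |: p.1, p.2))
                        (fun p => (p.1 :\ p.2, p.2))) /=; last first.
    by move=> [S x] /= /and3P[_ xS _]; rewrite setD1K.
  apply: eq_bigl => -[D y] /=; rewrite setU11 xpair_eqE eqxx andbT inE.
  have [yD|yD] := boolP (y \in D).
    rewrite /= andbF; apply/negbTE; rewrite negb_and; apply/orP; right.
    by apply: contraL yD => /eqP <-; rewrite !inE eqxx.
  by rewrite setU1K// eqxx andbT andbC.
have room_dominant (D : {set X}) : #|D|.+1 = #|I| ->
    [set y in ~: D | room (y |: D)] = [set y in ~: D | dominant (y |: D)].
  move=> cD; apply/setP => y; rewrite !inE; apply: andb_id2l => yD.
  by rewrite /room cardsU1 yD add1n cD eqxx.
have e_inj : injective e := can_inj ec.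
have odd_walls : odd (\sum_(D | wall D) #|[set y in ~: D | room (y |: D)]|).
  have ceI (A : {set I}) : c @: (e @: A) = A.
    by rewrite -imset_comp (eq_imset _ ec) imset_id.
  rewrite (bigD1 (e @: [set~ i0])) /=; last by rewrite /wall ceI.
  have ce : #|e @: [set~ i0]|.+1 = #|I|.
    by rewrite card_imset// cardsC1 prednK//; apply/card_gt0P; exists i0.
  rewrite oddD room_dominant// (single_slack_room i0 x0e e_inj) /=.
  apply: even_sum => D /andP[/eqP wD De].
  have [cD|cD] := eqVneq #|D|.+1 #|I|; last first.
    rewrite (_ : [set _ in _ | _] = set0) ?cards0//.
    apply/setP => y; rewrite !inE; apply/negP => /andP[yD /andP[]].
    by rewrite cardsU1 yD add1n (negbTE cD).
  rewrite room_dominant//; apply: even_door_rooms => //.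
  (* Since c (e j) = j, a wall inside the range of e is the boundary wall. *)
  apply: contra De => /subsetP sDe; rewrite -wD -imset_comp; apply/eqP.
  rewrite -[LHS]imset_id; apply: eq_in_imset => x /sDe /codomP[j ->] /=.
  by rewrite ec.
have [S /andP[/andP[/eqP cS domS] /eqP cT]|none] :=
  pickP [pred S : {set X} | room S && (c @: S == [set: I])].
  by exists S.
suff /negP[] :
  ~~ odd (\sum_(D | wall D) #|[set y in ~: D | room (y |: D)]|) by [].
rewrite -count; apply: even_sum => S rS.
have /andP[/eqP cS _] := rS.
by rewrite odd_color_walls//; have /= := none S; rewrite rS /= => ->.
Qed.
End Scarf.

(** * Colourings of the grid points of a simplex *)

Section Grid.
Variables (I : finType) (n : nat).

Definition in_grid (x : {ffun I -> 'I_n.+1}) := \sum_i x i == n.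

Lemma grid_above (i0 : I) (f : I -> nat) : \sum_i f i <= n ->
  exists2 x, in_grid x & forall i, f i <= x i.
Proof.
move=> fn; pose g i := f i + (n - \sum_i f i) * (i == i0).
have sg : \sum_i g i = n.
  rewrite big_split /= -big_distrr /=.
  have -> : \sum_i ((i == i0) : nat) = 1.
    by rewrite (bigD1 i0)//= eqxx big1// => i /negbTE ->.
  by rewrite muln1 subnKC.
have gn i : g i < n.+1 by rewrite ltnS -[X in _ <= X]sg (bigD1 i)//= leq_addr.
exists [ffun i => inord (g i)].
  by rewrite /in_grid; under eq_bigr do rewrite ffunE inordK//; rewrite sg.
by move=> i; rewrite ffunE inordK// leq_addr.
Qed.

(** [scarf_colorful_room] is applied to the grid points ordered by each
    coordinate (ties broken by an enumeration) together with one extra point per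
    index, which has that index as its colour.  The cell [S] obtained has
    minimal coordinates [a i] over its grid points.  Over the indices whose
    extra point is not in [S] they nearly add up to [n], since otherwise some
    grid point would exceed all of them; hence the grid points of [S] differ by
    less than [#|I|] in every coordinate.  Each of those indices is the colour
    of a grid point of [S]; for the others the coordinate is less than
    [#|I|]. *)
Lemma grid_colorful (i0 : I) (c : {ffun I -> 'I_n.+1} -> I) :
  exists2 x, in_grid x &
    forall i, x i < #|I| \/
      exists y, [/\ in_grid y, c y = i &
                    forall j, x j < y j + #|I| /\ y j < x j + #|I|].
Proof.
pose T := {x : {ffun I -> 'I_n.+1} | in_grid x}.
pose B := #|{: T}|; pose K := n.+1 * B.
pose k (i : I) (y : T + I) := match y with
  | inl t => (val t i * B + enum_rank t).+1
  | inr j => if j == i then 0 else (K + enum_rank j).+1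
  end.
have k_lt (t : T) i : val t i * B + enum_rank t < K.
  rewrite /K; apply: (@leq_trans ((val t i).+1 * B)).
    by rewrite mulSn addnC ltn_add2r.
  by rewrite leq_mul2r ltn_ord orbT.
have k_inj i : injective (k i).
  have e_lt (a b a' b' : nat) : b < B -> b' < B ->
      a * B + b = a' * B + b' -> b = b'.
    by move=> bB bB' /(congr1 (modn^~ B)); rewrite !modnMDl !modn_small.
  move=> [t|j] [t'|j'] /=.
  - by move=> [] /e_lt e; congr inl; apply/enum_rank_inj/val_inj/e.
  - case: ifP => // _ [] tj; have := k_lt t i.
    by rewrite tj -{2}[K]addn0 ltn_add2l.
  - case: ifP => // _ [] tj; have := k_lt t' i.
    by rewrite -tj -{2}[K]addn0 ltn_add2l.
  case: eqP => [->|_]; case: eqP => [->|_] //= [] /addnI /val_inj.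
  by move=> /enum_rank_inj ->.
have k_le i (t t' : T) : k i (inl t) <= k i (inl t') -> val t i <= val t' i.
  rewrite /= ltnS; apply: contraTT; rewrite -!ltnNge => t't.
  apply: (@leq_trans ((val t' i).+1 * B)); first
    by rewrite mulSn addnC ltn_add2r.
  by apply: leq_trans (leq_addr _ _); rewrite leq_mul2r t't orbT.
pose e (i : I) : T + I := inr i.
have inl_e t : inl t \notin codom e by apply/codomP => -[].
have e_min i y : k i (e i) <= k i y by rewrite /= eqxx.
have e_top i j y : i != j -> y \notin codom e -> k i y < k i (e j).
  move=> ij; case: y => [t _|l]; last by rewrite codom_f.
  by rewrite /= eq_sym (negbTE ij) ltnS (leq_trans (k_lt _ _))// leq_addr.
pose c' (y : T + I) := match y with inl t => c (val t) | inr j => j end.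
have ec : cancel e c' by [].
have [x0 x0P _] : exists2 x, in_grid x & forall i, 0 <= x i.
  by apply: (@grid_above i0 (fun=> 0)); rewrite big1.
have [S [_ /dominantP domS cS]] :=
  scarf_colorful_room k_inj e_min e_top (inl_e (exist _ x0 x0P)) ec.
pose inS (t : T) := inl t \in S.
have colored i : inr i \notin S -> exists2 t : T, inS t & c (val t) = i.
  move=> iS; have /imsetP[[t tS it|j jS ij]] : i \in c' @: S by rewrite cS inE.
    by exists t.
  by case/negP: iS; rewrite ij.
have domS' (t : T) : exists2 i, inr i \notin S &
    forall t', inS t' -> val t i <= val t' i.
  have [i Hi] := domS (inl t); exists i; last by move=> t' /Hi/k_le.
  by apply/negP => /Hi; rewrite /= eqxx.
have [i1 /colored[s0 s0S _] _] := domS' (exist _ x0 x0P).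
pose a i := val [arg min_(t < s0 | inS t) (val t i : nat)] i.
have aP i : (forall t, inS t -> a i <= val t i).
  by rewrite /a; case: arg_minnP.
have aS i : exists2 t, inS t & a i = val t i.
  by rewrite /a; case: arg_minnP => // t tS _; exists t.
(* f i is the least value of the coordinate i that escapes domination by S;
   indices whose extra point lies in S impose nothing. *)
pose f i : nat := if inr i \in S then 0 else (a i).+1.
have nf : n < \sum_i f i.
  rewrite ltnNge; apply/negP => /(grid_above i0)[t tP ft].
  have [i iS Hi] := domS' (exist _ t tP).
  have [t' t'S at'] := aS i.
  have := leq_trans (ft i) (Hi _ t'S).
  by rewrite /f (negbTE iS) at' ltnn.
have f_le t i : inS t -> f i <= (val t i).+1.
  by move=> tS; rewrite /f; case: ifP => // _; apply: aP.
have lt_f t j : inS t -> val t j < f j + #|I|.-1.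
  move=> tS; have := valP t; rewrite /in_grid (bigD1 j)//= => /eqP tn.
  have lt_s : val t j + \sum_(i | i != j) val t i < f j + \sum_(i | i != j) f i.
    by rewrite tn; move: nf; rewrite (bigD1 j).
  rewrite -(ltn_add2r (\sum_(i | i != j) val t i)); apply: leq_trans lt_s _.
  rewrite -addnA leq_add2l.
  apply: (@leq_trans (\sum_(i | i != j) (1 + val t i))).
    by apply: leq_sum => i _; rewrite add1n f_le.
  by rewrite big_split /= sum1_card cardC1.
have I_gt0 : 0 < #|I| by apply/card_gt0P; exists i0.
exists (val s0); first exact: valP.
move=> i; have [iS|/colored[t tS ti]] := boolP (inr i \in S); [left|right].
  by apply: leq_trans (lt_f _ _ s0S) _; rewrite /f iS add0n leq_pred.
have near u v j : inS u -> inS v -> val u j < val v j + #|I|.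
  move=> uS vS; apply: leq_trans (lt_f _ j uS) _.
  by rewrite -[X in _ <= _ + X]prednK// addnS -addSn leq_add2r f_le.
by exists (val t); split; [exact: valP|exact: ti|move=> j; rewrite !near].
Qed.
End Grid.

Import Order.TTheory GRing.Theory Num.Theory.
Import numFieldNormedType.Exports.

Local Open Scope classical_set_scope.
Local Open Scope ring_scope.

(** * Closed covers of the simplex *)

Lemma rV_entry_le_norm (R : realType) n (v : 'rV[R]_n) i : `|v ord0 i| <= `|v|.
Proof.
rewrite [leRHS]mx_normrE.
exact: (le_bigmax _ (fun ij : 'I_1 * 'I_n => `|v ij.1 ij.2|) (ord0, i)).
Qed.

Definition simplex (R : realType) m : set 'rV[R]_m :=
  [set l | (forall i, 0 <= l ord0 i) /\ \sum_i l ord0 i = 1].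

Lemma continuous_sum_coord (R : realType) m (a : 'I_m -> R) :
  continuous (fun l : 'rV[R]_m => \sum_i l ord0 i * a i).
Proof.
apply: continuous_big => [|i _ l]; first exact: add_continuous.
exact: (cvgM (@coord_continuous R 1 m ord0 i l) (cvg_cst _)).
Qed.

Lemma simplex_compact (R : realType) m : compact (@simplex R m).
Proof.
apply: (subclosed_compact _
  (rV_compact (fun _ : 'I_m => @segment_compact R 0 1))).
  have -> : @simplex R m = \bigcap_i [set l | 0 <= l ord0 i] `&`
      [set l | \sum_i l ord0 i * 1 = 1].
    rewrite predeqE => l; split=> [[l0 l1]|[l0 l1]].
      split; first by move=> i _; exact: l0.
      by rewrite /= -[RHS]l1; under eq_bigr do rewrite mulr1.
    split=> [i|]; first exact: l0.
    by rewrite -[RHS]l1; under [RHS]eq_bigr do rewrite mulr1.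
  apply: closedI.
    apply: closed_bigI => i _.
    apply: (preimage_closed _ (@closed_ge R 0)) => l _.
    exact: coord_continuous.
  apply: (preimage_closed _ (@closed_eq R 1)) => l _.
  exact: continuous_sum_coord.
move=> l [l0 l1] i /=; rewrite in_itv /= l0 /= -l1 (bigD1 i)//= lerDl.
by apply: sumr_ge0.
Qed.

(** A dual form of the Knaster-Kuratowski-Mazurkiewicz lemma.  Colour each grid
    point of mesh [1 / n.+1] by a member of the cover containing it; by
    [grid_colorful] some point [l] is, for every [i], within [m / n.+1] of [F i]
    unless its coordinate [i] is below [m / n.+1].  A cluster point of these
    [l] lies in [F i] as soon as its coordinate [i] is positive. *)
Lemma simplex_closed_cover (R : realType) m (F : 'I_m -> set 'rV[R]_m) :
  (0 < m)%N -> (forall i, closed (F i)) -> @simplex R m `<=` \bigcup_i F i ->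
  exists2 l, simplex l & forall i, 0 < l ord0 i -> F i l.
Proof.
move=> m_gt0 Fcl Fcov; pose i0 := Ordinal m_gt0.
pose d n : R := m%:R / n.+1%:R.
pose close n (l l' : 'rV[R]_m) := forall j, `|l ord0 j - l' ord0 j| < d n.
have approx n : exists l : 'rV[R]_m, simplex l /\ forall i,
    l ord0 i < d n \/ exists2 l', F i l' & close n l l'.
  pose v (x : {ffun 'I_m -> 'I_n.+2}) : 'rV[R]_m :=
    \row_i ((x i : nat)%:R / n.+1%:R).
  have n0 : (n.+1%:R : R) != 0 by rewrite pnatr_eq0.
  have v_simplex x : in_grid x -> simplex (v x).
    move=> /eqP xn; split=> [i|]; first by rewrite mxE divr_ge0.
    under eq_bigr do rewrite mxE; rewrite -mulr_suml -natr_sum xn.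
    by rewrite divff.
  have Fc (x : {ffun 'I_m -> 'I_n.+2}) : exists i, in_grid x -> F i (v x).
    have [xg|xg] := boolP (in_grid x); last by exists i0.
    by have [i _ Fi] := Fcov _ (v_simplex x xg); exists i.
  have [c cF] := choice Fc.
  have [x xg Hx] := grid_colorful i0 c.
  exists (v x); split; first exact: v_simplex.
  move=> i; have [lt_xi|[y [yg cy xy]]] := Hx i; [left|right].
    by rewrite mxE ltr_pM2r ?invr_gt0// ltr_nat -[X in (_ < X)%N]card_ord.
  exists (v y); first by rewrite -cy; apply: cF.
  move=> j; rewrite !mxE -mulrBl normrM [X in _ * X]ger0_norm ?invr_ge0//.
  rewrite ltr_pM2r ?invr_gt0// ltr_norml.
  have [/=] := xy j; rewrite !card_ord -!(ltr_nat R) !natrD => h1 h2.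
  by apply/andP; split; lra.
have [u uP] := choice approx.
have uS : (u @ \oo) (@simplex R m) by exists 0%N => // n _; exact: (uP n).1.
have [l [lS lcl]] := @simplex_compact R m (u @ \oo) _ uS.
exists l => // i li; apply: Fcl => B /nbhs_ballP[e /= e0 eB].
(* The half leaves room for two errors of size r. *)
pose r := Num.min e (l ord0 i) / 2.
have r0 : 0 < r by rewrite divr_gt0// lt_min e0.
have dr : \forall n \near \oo, d n < r.
  have rm : 0 < r / m%:R by rewrite divr_gt0// ltr0n.
  near=> n; rewrite /d mulrC -ltr_pdivlMr ?ltr0n//.
  by near: n; exact: (near_infty_natSinv_lt (PosNum rm)).
have [_ [[n dn <-] uln]] :
    [set u n | n in [set n | d n < r]] `&` ball l r !=set0.
  apply: lcl; last exact: nbhsx_ballx.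
  by apply: filterS dr => n dn; exists n.
have {}uln j : `|l ord0 j - u n ord0 j| < r by apply: uln.2.
have r_e : r + r <= e by rewrite -splitr ge_min lexx.
have r_l : r + r <= l ord0 i by rewrite -splitr ge_min lexx orbT.
have [un_i|[l' Fl' ull']] := (uP n).2 i.
  have := uln i; rewrite ltr_norml => /andP[_ li_r].
  by exfalso; move: dn; rewrite /= => dn; lra.
exists l'; split=> //; apply: eB; split=> // i' j; rewrite (ord1 i').
rewrite /ball /=; apply: lt_le_trans r_e.
rewrite -[X in `|X|](subrKA (u n ord0 j)).
by apply: le_lt_trans (ler_normD _ _) _; rewrite ltrD// (lt_trans (ull' j)).
Unshelve. all: by end_near.
Qed.

Lemma compact_finite_subcover (T : ptopologicalType) (J : choiceType)
    (A : set T) (D : set J) (f : J -> set T) :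
  compact A -> (forall j, D j -> open (f j)) -> A `<=` \bigcup_(j in D) f j ->
  exists m (s : 'I_m -> J),
    (forall i, D (s i)) /\ A `<=` \bigcup_i f (s i).
Proof.
rewrite compact_cover => cA f_open /(cA J D f f_open)[D' sD' cov].
pose e : seq J := finmap.enum_fset D'.
exists (size e), (tnth (in_tuple e)); split.
  by move=> i; apply/set_mem/sD'; apply: mem_tnth.
move=> x /cov[j /= jD' fjx]; have /tnthP[i ji] : j \in in_tuple e by [].
by exists i => //; rewrite -ji.
Qed.

(** * Convexity and the inner product *)

Section Inner.
Variables (R : realType) (N : nat).
Implicit Types u v w : 'rV[R]_N.

Lemma innerBl u v w : inner (u - v) w = inner u w - inner v w.
Proof.
by rewrite -sumrB; apply: eq_bigr => i _; rewrite !mxE mulrBl.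
Qed.

Lemma inner_convr u v w t :
  inner u (t *: v + (1 - t) *: w) = t * inner u v + (1 - t) * inner u w.
Proof.
rewrite !mulr_sumr -big_split; apply: eq_bigr => i _ /=; rewrite !mxE.
by ring.
Qed.

Lemma inner_suml m (a : 'I_m -> R) (p : 'I_m -> 'rV[R]_N) v :
  inner (\sum_i a i *: p i) v = \sum_i a i * inner (p i) v.
Proof.
under [RHS]eq_bigr do rewrite mulr_sumr.
rewrite exchange_big; apply: eq_bigr => j _ /=.
by rewrite summxE mulr_suml; apply: eq_bigr => i _; rewrite mxE mulrA.
Qed.

Lemma inner_norm u v : `|inner u v| <= N%:R * (`|u| * `|v|).
Proof.
apply: le_trans (ler_norm_sum _ _ _) _.
rewrite mulr_natl -[X in _ *+ X]card_ord -sumr_const; apply: ler_sum => i _.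
by rewrite normrM ler_pM// rV_entry_le_norm.
Qed.

Lemma continuous_inner u : continuous (inner u).
Proof.
rewrite (_ : inner u = fun v => \sum_i v ord0 i * u ord0 i).
  exact: continuous_sum_coord.
by apply/funext => v; apply: eq_bigr => i _; rewrite mulrC.
Qed.

Lemma convex_set2 (A : set 'rV[R]_N) u v t : convex_set A -> A u -> A v ->
  0 <= t -> t <= 1 -> A (t *: u + (1 - t) *: v).
Proof.
move=> cA Au Av t0 t1; apply/set_mem.
by apply: (cA u v (Itv01 t0 t1)); rewrite inE.
Qed.

(** The induction carries unnormalised sums: either the weights so far vanish,
    or their weighted sum divided by the total weight is in [A]. *)
Lemma convex_set_simplex (A : set 'rV[R]_N) m (p : 'I_m -> 'rV[R]_N)
    (l : 'rV[R]_m) : convex_set A -> (forall i, A (p i)) -> simplex l ->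
  A (\sum_i l ord0 i *: p i).
Proof.
move=> cA Ap [l0 l1].
pose P (W : R) v := (W = 0 /\ v = 0) \/ (0 < W /\ A (W^-1 *: v)).
have : P (\sum_i l ord0 i) (\sum_i l ord0 i *: p i).
  apply: (big_rec2 P); first by left.
  move=> i W v _ PWv; have [li0|li0] := eqVneq (l ord0 i) 0.
    by rewrite li0 add0r scale0r add0r.
  have li_gt0 : 0 < l ord0 i by rewrite lt_def li0 l0.
  right; case: PWv => [[-> ->]|[W0 AW]].
    by rewrite !addr0 scalerK.
  have S0 : 0 < l ord0 i + W by rewrite addr_gt0.
  split=> //; pose t := l ord0 i / (l ord0 i + W).
  have -> : (l ord0 i + W)^-1 *: (l ord0 i *: p i + v) =
      t *: p i + (1 - t) *: (W^-1 *: v).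
    rewrite scalerDr !scalerA mulrC; congr (_ + _ *: _).
    rewrite /t; field; rewrite !lt0r_neq0//.
  apply: convex_set2 => //; first by rewrite divr_ge0// ltW.
  by rewrite ler_pdivrMr// mul1r lerDl ltW.
case=> [[]|[_]]; rewrite l1; last by rewrite invr1 scale1r.
by move/eqP; rewrite oner_eq0.
Qed.

(** A separation theorem proved by minimising [\sum_i (max 0 <d i, z>)^2] over
    [K].  At a minimiser [z0], the first-order condition in the direction of [z]
    says that the weights [a i = max 0 <d i, z0>] satisfy
    [\sum_i a i * <d i, z> >= \sum_i a i * <d i, z0>], and the right-hand side
    is the minimum itself, which is positive. *)
Lemma convex_alternative m (d : 'I_m -> 'rV[R]_N) (K : set 'rV[R]_N) :
  K !=set0 -> compact K -> convex_set K ->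
  (forall z, K z -> exists i, 0 < inner (d i) z) ->
  exists2 w : 'rV[R]_m, simplex w &
    forall z, K z -> 0 < \sum_i w ord0 i * inner (d i) z.
Proof.
move=> K0 cK convK Kd.
pose pos (x : R) := Num.max 0 x.
pose phi z := \sum_i pos (inner (d i) z) ^+ 2.
have phi_cont : continuous phi.
  apply: continuous_big => [|i _ z]; first exact: add_continuous.
  have pc : {for z, continuous (fun z => pos (inner (d i) z))}.
    by apply: continuous_max; [exact: cst_continuous|exact: continuous_inner].
  exact: (cvgM pc pc).
have [z0 /set_mem Kz0 z0_min] :=
  compact_EVT_min K0 cK (continuous_subspaceT phi_cont).
pose a i := pos (inner (d i) z0).
have a_ge0 i : 0 <= a i by rewrite /a /pos le_max lexx.
have aa i : a i * inner (d i) z0 = a i ^+ 2.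
  by rewrite expr2 /a /pos; case: (leP 0 (inner (d i) z0)); rewrite ?mul0r.
have [i0 di0] := Kd _ Kz0.
have ai0 : 0 < a i0 by rewrite /a /pos lt_max di0 orbT.
pose W := \sum_i a i.
have W0 : 0 < W.
  by rewrite /W (bigD1 i0)//= ltr_wpDr// sumr_ge0.
have phi0 : 0 < phi z0.
  rewrite /phi (bigD1 i0)//=; apply: ltr_wpDr; last by rewrite exprn_gt0.
  by apply: sumr_ge0 => i _; rewrite exprn_ge0// (a_ge0 i).
exists (\row_i (a i / W)).
  split=> [i|]; first by rewrite mxE divr_ge0// ltW.
  by under eq_bigr do rewrite mxE; rewrite -mulr_suml divff// gt_eqF.
move=> z Kz; under eq_bigr do rewrite mxE mulrAC; rewrite -mulr_suml.
apply: divr_gt0 => //.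
pose b i := inner (d i) z - inner (d i) z0.
(* Half the derivative of phi at z0 in the direction z - z0. *)
pose g := \sum_i a i * b i.
have -> : \sum_i a i * inner (d i) z = g + phi z0.
  rewrite -big_split; apply: eq_bigr => i _ /=.
  by rewrite -/(a i) -aa -mulrDr subrK.
apply: ltr_wpDl => //.
pose Q := \sum_i b i ^+ 2.
have Q0 : 0 <= Q by apply: sumr_ge0 => i _; rewrite sqr_ge0.
have first_order t : 0 < t -> t <= 1 -> 0 <= 2 * g + t * Q.
  move=> t0 t1.
  have le_phi : phi z0 <= phi z0 + t * (2 * g + t * Q).
    have := z0_min (t *: z + (1 - t) *: z0).
    rewrite inE => /(_ (convex_set2 convK Kz Kz0 (ltW t0) t1)) /le_trans; apply.
    rewrite mulrDr mulrA [t * 2]mulrC -!mulrA /g /Q !mulr_sumr -!big_split /=.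
    apply: ler_sum => i _; rewrite inner_convr -/(a i).
    have -> : t * inner (d i) z + (1 - t) * inner (d i) z0 =
        inner (d i) z0 + t * b i by rewrite /b; ring.
    have -> : a i ^+ 2 + (2 * (t * (a i * b i)) + t * (t * b i ^+ 2)) =
        (a i + t * b i) ^+ 2 by ring.
    have lea : inner (d i) z0 <= a i by rewrite /a /pos le_max lexx orbT.
    rewrite /pos; case: (leP 0 (inner (d i) z0 + t * b i)) => h.
      by rewrite ler_sqr ?nnegrE; lra.
    by rewrite expr0n /= sqr_ge0.
  by move: le_phi; rewrite lerDl pmulr_rge0.
rewrite leNgt; apply/negP => g0.
(* A step so short that the quadratic term is at most - g. *)
pose t := Num.min 1 (- g / (Q + 1)).
have Q1 : 0 < Q + 1 by lra.
have t0 : 0 < t by rewrite /t lt_min ltr01 divr_gt0// oppr_gt0.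
have t1 : t <= 1 by rewrite /t ge_min lexx.
have tQ : t * (Q + 1) <= - g.
  by rewrite -ler_pdivlMr// /t ge_min lexx orbT.
have := first_order t t0 t1; nra.
Qed.
End Inner.

(** * Improving directions and the theorem *)

(** By compactness of [zeta x] finitely many of the improving points suffice,
    and [convex_alternative] mixes them into a single [p]; by upper
    semi-continuity the same [p] works on a whole neighbourhood of [x].  That
    neighbourhood is a closed ball so as to provide the closed cover required by
    [simplex_closed_cover]. *)
Lemma improving_direction_near (R : realType) (N : nat) (C : set 'rV[R]_N)
    (zeta : correspondence C 'rV[R]_N) (x : C) :
  convex_set C -> zeta x !=set0 -> convex_set (zeta x) -> compact (zeta x) ->
  upper_semicontinuous_at zeta x ->
  (forall z, zeta x z -> exists2 p, C p & inner (set_val x) z < inner p z) ->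
  exists2 p, C p & exists2 r, 0 < r &
    forall y : C, `|set_val x - set_val y| <= r ->
    forall z, zeta y z -> 0 < inner (p - set_val y) z.
Proof.
move=> convC K0 convK cK usc improv; set x0 := set_val x.
pose pos_on p : set 'rV[R]_N := [set z | 0 < inner (p - x0) z].
have pos_open p : open (pos_on p).
  apply: (@open_comp _ _ (inner (p - x0)) [set t | 0 < t]) => [z _|].
    exact: continuous_inner.
  exact: open_gt.
have [|m [s [sC cov]]] :=
    @compact_finite_subcover _ _ _ C pos_on cK (fun p _ => pos_open p).
  move=> z /improv[p Cp lt_xp]; exists p => //.
  by rewrite /pos_on /= innerBl subr_gt0.
have [z Kz|w wS w_pos] :=
    @convex_alternative R N m (fun i => s i - x0) _ K0 cK convK.
  by have [i _ pi] := cov _ Kz; exists i.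
pose p := \sum_i w ord0 i *: s i.
have Cp : C p by apply: convex_set_simplex.
have p_pos z : zeta x z -> 0 < inner (p - x0) z.
  move=> /w_pos; rewrite innerBl inner_suml.
  under eq_bigr do rewrite innerBl mulrBr.
  by rewrite sumrB -mulr_suml wS.2 mul1r.
have [z1 /set_mem Kz1 z1_min] := compact_EVT_min K0 cK
  (continuous_subspaceT (@continuous_inner R N (p - x0))).
pose d := inner (p - x0) z1 / 2.
have d0 : 0 < d by rewrite divr_gt0// p_pos.
have [M M0 KM] : exists2 M : R, 0 < M & forall z, zeta x z -> `|z| < M.
  have [M [_ KM]] := compact_bounded cK.
  exists (`|M| + 2) => [|z Kz]; first by rewrite ltr_wpDl.
  apply: (@le_lt_trans _ _ (`|M| + 1)); last by rewrite ltrD2l ltr1n.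
  by apply: KM => //; rewrite (le_lt_trans (ler_norm M))// ltrDl.
(* Boundedness of V controls the change of the inner product with z when x0 is
   replaced by a nearby point. *)
pose V := [set z | d < inner (p - x0) z] `&` [set z : 'rV[R]_N | `|z| < M].
have V_open : open V.
  apply: openI.
    apply: (@open_comp _ _ (inner (p - x0)) [set t | d < t]) => [z _|].
      exact: continuous_inner.
    exact: open_gt.
  apply: (@open_comp _ _ (Num.norm : 'rV[R]_N -> R) [set t | t < M]) => [z _|].
    exact: norm_continuous.
  exact: open_lt.
have sV : zeta x `<=` V.
  move=> z Kz; split; last exact: KM.
  have /= := z1_min z; rewrite inE => /(_ Kz); apply: lt_le_trans.
  by rewrite /d ltr_pdivrMr// ltr_pMr ?ltr1n// p_pos.
have [U [_ [[W W_open <-] Wx] sWU] UV] := usc V V_open sV.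
have [e /= e0 eW] : nbhs_ball x0 W.
  by apply/nbhs_ballP; apply: open_nbhs_nbhs.
exists p => //; exists (Num.min (e / 2) (d / (N.+1%:R * M))).
  by rewrite lt_min (divr_gt0 e0)// (divr_gt0 d0)// mulr_gt0.
move=> y; rewrite le_min => /andP[ye yd] z yz.
have [dz zM] : V z.
  apply: UV; exists y => //; apply/sWU/eW; rewrite -ball_normE /=.
  by rewrite (le_lt_trans ye)// ltr_pdivrMr// ltr_pMr ?ltr1n.
have -> : inner (p - set_val y) z =
    inner (p - x0) z + inner (x0 - set_val y) z.
  by rewrite !innerBl subrKA.
have : `|inner (x0 - set_val y) z| <= d.
  apply: le_trans (inner_norm _ _) _.
  apply: (@le_trans _ _ (N.+1%:R * (d / (N.+1%:R * M) * M))).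
    by rewrite ler_pM ?mulr_ge0 ?ler_nat// ler_pM// ltW.
  rewrite [leLHS](_ : _ = d)//; generalize d => d'; field.
  by rewrite lt0r_neq0// addrC natr1 pnatr_eq0.
rewrite ler_norml => /andP[? _]; move: dz => /= dz; lra.
Qed.

(* [C], used as a type, is the subtype [set_type C] with the induced topology. *)
Theorem theorem2p2 (R : realType) (N : nat) (C : set 'rV[R]_N)
    (C_neq0 : C !=set0) (C_compact : compact C) (C_convex : convex_set C)
    (zeta : correspondence C 'rV[R]_N)
    (zeta_neq0 : forall x : C, zeta x !=set0)
    (zeta_convex : forall x : C, convex_set (zeta x))
    (zeta_compact : forall x : C, compact (zeta x))
    (zeta_usc : upper_semicontinuous zeta) :
  exists (x : C) (z : 'rV[R]_N), zeta x z /\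
    forall p : 'rV[R]_N, C p -> inner p z <= inner (set_val x) z.
Proof.
apply: contrapT => no_sol.
have improv (x : C) z :
    zeta x z -> exists2 p, C p & inner (set_val x) z < inner p z.
  move=> xz; apply: contrapT => no_p; apply: no_sol.
  exists x, z; split=> // p Cp.
  by rewrite leNgt; apply/negP => lt_xp; apply: no_p; exists p.
have local (x : 'rV[R]_N) : exists pr : 'rV[R]_N * R,
    C x -> [/\ C pr.1, 0 < pr.2 &
    forall y : C, `|x - set_val y| <= pr.2 ->
    forall z, zeta y z -> 0 < inner (pr.1 - set_val y) z].
  have [Cx|nCx] := pselect (C x); last by exists (0, 0).
  pose x' : C := exist _ x (mem_set Cx).
  have [p Cp [r r0 pr]] := improving_direction_near C_convex (zeta_neq0 x')
    (zeta_convex x') (zeta_compact x') (zeta_usc x') (improv x').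
  by exists (p, r).
have [pr prP] := choice local.
have [||m [s [sC cov]]] := @compact_finite_subcover _ _ _ C
    (fun x => ball x (pr x).2) C_compact.
- by move=> x Cx; apply: ball_open; have [] := prP x Cx.
- move=> x Cx; exists x => //; apply: ballxx.
  by have [] := prP x Cx.
pose p i := (pr (s i)).1.
pose y (l : 'rV[R]_m) := \sum_i l ord0 i *: p i.
have yC l : simplex l -> C (y l).
  by move=> lS; apply: convex_set_simplex => // i; have [] := prP _ (sC i).
pose F i := [set l | `|s i - y l| <= (pr (s i)).2].
have y_cont : continuous y.
  apply: continuous_big => [|i _ l]; first exact: add_continuous.
  exact: (cvgZr_tmp (@coord_continuous R 1 m ord0 i l)).
have F_closed i : closed (F i).
  apply: (@preimage_closed _ _ (fun l => `|s i - y l|)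
    [set t | t <= (pr (s i)).2]) => [l _|]; last exact: closed_le.
  have yB : {for l, continuous (fun l => s i - y l)}.
    by apply: continuousB; [exact: cst_continuous|exact: y_cont].
  exact: (continuous_comp yB (@norm_continuous _ _ _)).
have [x0 Cx0] := C_neq0; have [i0 _ _] := cov _ Cx0.
have m_gt0 : (0 < m)%N := leq_ltn_trans (leq0n i0) (ltn_ord i0).
have [|l lS lF] := simplex_closed_cover m_gt0 F_closed.
  move=> l /yC /cov[i _ li]; exists i => //; move: li.
  by rewrite -ball_normE => /ltW.
pose yl : C := exist _ (y l) (mem_set (yC l lS)).
have [z yz] := zeta_neq0 yl.
have term i : 0 < l ord0 i -> 0 < l ord0 i * inner (p i - y l) z.
  move=> li; rewrite mulr_gt0//; have [_ _ Hi] := prP _ (sC i).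
  exact: (Hi yl (lF i li)).
have [j lj] : exists j, 0 < l ord0 j.
  apply: contrapT => l_npos; suff : (1 : R) <= 0 by rewrite ler10.
  rewrite -lS.2; apply: sumr_le0 => i _; rewrite leNgt; apply/negP => li.
  by apply: l_npos; exists i.
(* Each p i of positive weight improves upon y l, yet y l is their mean. *)
have : 0 < \sum_i l ord0 i * inner (p i - y l) z.
  rewrite (bigD1 j)//=; apply: ltr_wpDr; last exact: term.
  apply: sumr_ge0 => i _; have [->|li] := eqVneq (l ord0 i) 0.
    by rewrite mul0r.
  by apply/ltW/term; rewrite lt_def li lS.1.
under eq_bigr do rewrite innerBl mulrBr.
by rewrite sumrB -mulr_suml lS.2 mul1r /y inner_suml subrr ltxx.
Qed.
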